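(* There exist constants $C,C'>0$ such that the following holds. Let $f:\mathbb{R}^+\to\mathbb{R}^+$ be non-decreasing with $f(x)\ge2$ for all $x>0$ and $f(x)\le\log x$ for all $x\ge e^2$. Let $0<\varepsilon<\frac1{100}$, $k:=C\lceil\frac1{\varepsilon^2}\log^4\frac1\varepsilon\rceil$, and let $\delta$ be defined by $1/\delta=C'k^{f(k)-1}$. Let $T$ be an $h$-vertex tournament with the $f$-Erdős–Hajnal property, and let $G$ be an $n$-vertex tournament with fewer than $(\delta/k)^{h-1}n^h$ copies of $T$ (subtournaments isomorphic to $T$). Then $G$ has a vertex subset $S$ with $|S|\ge\delta n$ which is $\varepsilon$-transitive.
   Context: Logarithms are natural. A tournament is $T$-free if it has no subtournament isomorphic to $T$. $T$ has the $f$-Erdős–Hajnal property if for every real $k\ge1$, every $T$-free tournament with at least $k^{f(k)}$ vertices has a transitive subtournament on at least $k$ vertices. A vertex subset $S$ of a tournament is $\varepsilon$-transitive if the subtournament induced on $S$ can be made transitive by reversing at most $\varepsilon\binom{|S|}{2}$ edges. *)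

(* Defs.v *)
From HB Require Import structures.
From mathcomp Require Import all_boot all_order all_algebra.
From mathcomp Require Import reals sequences exp.
Set Implicit Arguments.
Unset Strict Implicit.
Unset Printing Implicit Defensive.
Import Order.TTheory GRing.Theory Num.Theory.
Local Open Scope ring_scope.

(* [e x y] means that the edge between x and y is directed from x to y. *)
Definition tournament (V : finType) (e : rel V) : Prop :=
  irreflexive e /\ forall x y : V, x != y -> e x y = ~~ e y x.

Definition transitive_on (V : finType) (e : rel V) (S : {set V}) : Prop :=
  {in S & &, transitive e}.

(* The subtournament of [e] induced on [S] is isomorphic to [t]. *)
Definition is_copy (W V : finType) (t : rel W) (e : rel V) (S : {set V}) :
    bool :=
  [exists phi : {ffun W -> V},
    [&& injectiveb phi, phi @: [set: W] == S
      & [forall x, forall y, e (phi x) (phi y) == t x y]]].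

(* Copies are counted as vertex subsets, not as labelled embeddings. *)
Definition num_copies (W V : finType) (t : rel W) (e : rel V) : nat :=
  #|[set S : {set V} | is_copy t e S]|.

Definition free_of (W V : finType) (t : rel W) (e : rel V) : Prop :=
  forall S : {set V}, ~~ is_copy t e S.

Definition erdos_hajnal (R : realType) (f : R -> R) (W : finType)
    (t : rel W) : Prop :=
  forall k : R, 1 <= k ->
  forall (V : finType) (e : rel V), tournament e -> free_of t e ->
    k `^ f k <= #|V|%:R ->
    exists S : {set V}, k <= #|S|%:R /\ transitive_on e S.

Definition edges_in (V : finType) (e : rel V) (S : {set V}) : {set V * V} :=
  [set p | [&& p.1 \in S, p.2 \in S & e p.1 p.2]].

Definition reverse_edges (V : finType) (e : rel V) (F : {set V * V}) : rel V :=
  fun x y => if ((x, y) \in F) || ((y, x) \in F) then e y x else e x y.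

Definition eps_transitive (R : realType) (eps : R) (V : finType) (e : rel V)
    (S : {set V}) : Prop :=
  exists F : {set V * V},
    [/\ F \subset edges_in e S,
        #|F|%:R <= eps * 'C(#|S|, 2)%:R
      & transitive_on (reverse_edges e F) S].

(* Main.v *)
Require Import Defs.
From HB Require Import structures.
From mathcomp Require Import all_boot all_order all_algebra.
From mathcomp Require Import reals sequences exp.
From mathcomp Require Import boolp zify ring lra.
Set Implicit Arguments.
Unset Strict Implicit.
Unset Printing Implicit Defensive.
Import Order.TTheory GRing.Theory Num.Theory.
Local Open Scope ring_scope.

(* Suppose that no set of at least delta n vertices is eps-transitive.  By
   sorting vertices by score, a set A that is not eps-transitive contains
   at least a constant times eps^2 |A|^3 cyclic triangles.  Hence, by a container
   argument, after choosing at most two vertices of a transitive subset X of A,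
   the rest of X lies in one of few sets of size at most
   (1 - c eps^2) |A|.  Iterating until the size drops below delta n
   bounds the number of transitive sets with at least k vertices.  In a random
   vertex subset with about 4 k^f(k) vertices, deleting one vertex from each copy
   of T and from each transitive k-set then leaves more than k^f(k) vertices, which
   contradicts the f-Erdos-Hajnal property of T.  If n < 4 k^f(k), the deletion
   is done in G itself, with delta n in place of k. *)

(** * Scores, cyclic triangles and distance to transitivity *)

Section Scores.
Local Open Scope nat_scope.
Variables (V : finType) (e : rel V).
Hypothesis eT : tournament e.

Definition score (A : {set V}) (x : V) : nat := \sum_(z in A) e x z.

Definition paths2 (A : {set V}) (x y : V) : nat :=
  \sum_(z in A) (e x z && e z y).

(** Every cyclic triangle is counted three times, once for each of its edges. *)
Definition cyclic_triples (A : {set V}) : nat :=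
  \sum_(x in A) \sum_(y in A) (e x y * paths2 A y x).

Lemma tournament_irr x : e x x = false.
Proof. by case: eT => irr _; exact: irr. Qed.

Lemma tournamentN x y : x != y -> e y x = ~~ e x y.
Proof. by case: eT => _ tot nxy; apply: tot; rewrite eq_sym. Qed.

(** The two sides agree vertex by vertex in [z]. As a consequence, an edge towards a vertex of
    larger score lies in more cyclic triangles than the gap in score. *)
Lemma paths2_score (A : {set V}) x y : x \in A -> y \in A -> e x y ->
  paths2 A y x + score A x = score A y + 1 + paths2 A x y.
Proof.
move=> xA yA exy; have -> : 1 = \sum_(z in A) (z == y).
  rewrite (bigD1 y)//= eqxx big1 ?addn0// => z /andP[_ /negPf ->] //.
rewrite -!big_split /=; apply: eq_bigr => z zA.
have nxy : x != y by apply: contraTneq exy => ->; rewrite tournament_irr.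
have [-> | nzy] := eqVneq z y; first by rewrite !tournament_irr exy.
have [-> | nzx] := eqVneq z x.
  by rewrite !tournament_irr (tournamentN nxy) exy.
rewrite (tournamentN (y := x) (x := z)) // (tournamentN (x := y)); last by rewrite eq_sym.
by case: (e z x); case: (e y z).
Qed.

Lemma edge_count (A : {set V}) :
  2 * (\sum_(x in A) score A x) + #|A| = #|A| * #|A|.
Proof.
have swap : \sum_(x in A) score A x = \sum_(x in A) \sum_(z in A) e z x.
  by rewrite exchange_big.
have -> : #|A| * #|A| = \sum_(x in A) \sum_(z in A) 1.
  by rewrite sum_nat_const sum1_card.
rewrite mul2n -addnn {2}swap -sum1_card -!big_split /=.
apply: eq_bigr => x xA.
rewrite [X in _ + X = _](_ : 1 = \sum_(z in A) (z == x)); last first.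
  by rewrite (bigD1 x)//= eqxx big1 ?addn0// => z /andP[_ /negPf ->].
rewrite -!big_split /=; apply: eq_bigr => z zA.
have [-> | nzx] := eqVneq z x; first by rewrite tournament_irr.
by rewrite (tournamentN nzx); case: (e z x).
Qed.

(** Every transitive triangle is counted once, through the edge from its source to its sink. *)
Definition transitive_triples (A : {set V}) : nat :=
  \sum_(x in A) \sum_(y in A) (e x y * paths2 A x y).

(** An ordered pair of out-neighbours of [x] either repeats a vertex or spans with [x] a transitive
    triangle with source [x], which is met in both orders. *)
Lemma transitive_triplesE (A : {set V}) :
  2 * transitive_triples A + \sum_(x in A) score A x
    = \sum_(x in A) score A x * score A x.
Proof.
rewrite /transitive_triples big_distrr -big_split /=; apply: eq_bigr => x xA.
have E1 : \sum_(y in A) e x y * paths2 A x y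
    = \sum_(y in A) \sum_(z in A) (e x y && e x z && e z y).
  apply: eq_bigr => y _; rewrite big_distrr /=; apply: eq_bigr => z _.
  by case: (e x y); case: (e x z); case: (e z y).
have E2 : \sum_(y in A) e x y * paths2 A x y
    = \sum_(y in A) \sum_(z in A) (e x y && e x z && e y z).
  rewrite E1 exchange_big; apply: eq_bigr => y _; apply: eq_bigr => z _ /=.
  by rewrite [e x z && _]andbC.
rewrite mul2n -addnn {1}E1 E2 big_distrlr /=.
rewrite [X in _ + X](_ : _ = \sum_(y in A) \sum_(z in A) (e x y && (z == y))); last first.
  apply: eq_bigr => y yA; rewrite (bigD1 y)//= eqxx andbT.
  by rewrite big1 ?addn0// => z /andP[_ /negPf->]; rewrite andbF.
rewrite -!big_split /=; apply: eq_bigr => y yA.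
rewrite -!big_split /=; apply: eq_bigr => z zA.
have [-> | nzy] := eqVneq z y; first by rewrite tournament_irr; case: (e x y).
by rewrite (tournamentN nzy); case: (e x y); case: (e x z); case: (e z y).
Qed.

(** Convexity: the sum of squared scores is least when all scores equal [(#|A| - 1) / 2]. *)
Lemma transitive_triples_ge (A : {set V}) :
  #|A| * (#|A| - 1) * #|A| <= 8 * transitive_triples A + 3 * (#|A| * (#|A| - 1)).
Proof.
have [->|/card_gt0P[x0 x0A]] := posnP #|A|; first by [].
have w0 : 0 < #|A| by apply/card_gt0P; exists x0.
have H1 := edge_count A; have H2 := transitive_triplesE A.
set E := \sum_(x in A) score A x in H1 H2 *.
set D := \sum_(x in A) _ in H2.
have H3 : 4 * (#|A| - 1) * E <= 4 * D + #|A| * ((#|A| - 1) * (#|A| - 1)).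
  rewrite -[X in _ + X * _]sum1_card /E /D !big_distrr big_distrl -big_split /=.
  apply: leq_sum => x _; have [+ _] := nat_Cauchy (2 * score A x) (#|A| - 1).
  by rewrite -!mulnn; move: (score A x) (#|A| - 1) => a b; nia.
case: #|A| H1 H3 w0 => // u; rewrite subSS subn0 => H1 H3 _.
have H4 : 4 * u * E = 2 * u * (u.+1 * u) by nia.
rewrite -H2 in H3; lia.
Qed.

Lemma sum_sub (W A : {set V}) (F : V -> nat) : W \subset A ->
  \sum_(x in W) F x = \sum_(x in A) (x \in W) * F x.
Proof.
move=> sWA; rewrite [RHS](bigID (mem W)) /= [X in _ + X]big1 ?addn0.
  apply: eq_big => x; last by move=> ->; rewrite mul1n.
  by rewrite andb_idl //; exact: (subsetP sWA).
by move=> x /andP[_ /negPf ->].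
Qed.

(** By [paths2_score], an edge of [W] closes fewer than 2s more transitive than cyclic triangles. By
    convexity an average edge of [W] closes about [#|W| / 4] transitive ones, so in a large [W] many
    cyclic ones remain. *)
Lemma concentrated_scores_edges (A W : {set V}) s : 0 < s -> W \subset A ->
  (forall x y, x \in W -> y \in W -> score A x < score A y + 2 * s) ->
  s * \sum_(x in W) score W x <= 7 * (s * s) * #|W| +
    \sum_(x in W) \sum_(y in W) e x y * paths2 A y x.
Proof.
move=> s0 sWA Ws; have H1 := edge_count W; have H2 := transitive_triples_ge W.
have H3 : transitive_triples W <=
    \sum_(x in W) \sum_(y in W) e x y * paths2 A y x
      + 2 * s * \sum_(x in W) score W x.
  rewrite /transitive_triples big_distrr -big_split /=; apply: leq_sum => x xW.
  rewrite big_distrr -big_split /=; apply: leq_sum => y yW.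
  case exy: (e x y); rewrite ?mul0n // !mul1n muln1.
  have := paths2_score (subsetP sWA _ xW) (subsetP sWA _ yW) exy.
  have := Ws _ _ xW yW.
  have : paths2 W x y <= paths2 A x y.
    rewrite /paths2 [X in _ <= X](bigID (mem W)) /=.
    rewrite [X in X + _](_ : _ = \sum_(z in W) (e x z && e z y)) ?leq_addr //.
    apply: eq_bigl => z; apply: andb_idl; exact: (subsetP sWA).
  lia.
set E := \sum_(x in W) score W x in H1 H3 *.
set S := \sum_(x in W) _ in H3 *.
have H4 : #|W| * (#|W| - 1) = 2 * E by rewrite mulnBr muln1 -H1 addnK.
rewrite H4 in H2.
(* A window with at most 14s vertices has at most [7 * s * #|W|] edges, which the first term
   absorbs. *)
have [le_w|lt_w] := leqP #|W| (14 * s).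
  have : E <= 7 * s * #|W| by nia.
  nia.
have : 2 * E * (12 * s + 3) <= 2 * E * #|W| by rewrite leq_mul2l; lia.
lia.
Qed.

Lemma sum_pred1_le1 (I : finType) (T : eqType) (f : I -> T) (q : T) :
  injective f -> \sum_i (q == f i) <= 1.
Proof.
move=> f_inj; case: (pickP (fun i => q == f i)) => [i /eqP qi | q0].
  rewrite (bigD1 i) //= {1}qi eqxx big1 ?addn0 // => j nji.
  by rewrite qi (inj_eq f_inj) eq_sym (negPf nji).
by rewrite big1 // => i _; rewrite q0.
Qed.

(* Order by decreasing score.  If an edge x -> y goes backwards, then either the
   gap in score is at least s and the edge lies in more than s cyclic triangles,
   or x and y lie in a common window of scores of length 2s; in a window with
   many more than s vertices the edges lie, on average, in at least s cyclic
   triangles. *)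
Lemma feedback_set (A : {set V}) s : 0 < s ->
  exists F : {set V * V}, [/\ F \subset edges_in e A,
    s * #|F| <= 3 * cyclic_triples A + 14 * (s * s) * #|A|
    & transitive_on (reverse_edges e F) A].
Proof.
move=> s0; pose d := score A.
pose before x y := (d y < d x) || (d x == d y) && (enum_rank x < enum_rank y).
exists [set p | [&& p.1 \in A, p.2 \in A, e p.1 p.2 & before p.2 p.1]].
split; first by apply/subsetP => p; rewrite !inE => /and4P[-> -> ->].
  set F := [set p | _].
  (* Two consecutive score classes of width [s] form a window. Windows overlap, so vertices whose
     scores differ by less than [s] share one, while each vertex lies in at most two. *)
  pose win (j : 'I_(#|A|.+1)) :=
    [set x in A | (d x %/ s == j) || (d x %/ s == j.+1)].
  pose tau x y := e x y * paths2 A y x.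
  have winA j : win j \subset A by apply/subsetP => x; rewrite inE => /andP[].
  have win2 x : \sum_j (x \in win j) <= 2.
    apply: (@leq_trans (\sum_(j < #|A|.+1) (d x %/ s == j)
                        + \sum_(j < #|A|.+1) (d x %/ s == j.+1))).
      rewrite -big_split /=; apply: leq_sum => j _; rewrite inE.
      move: (_ == _ :> nat) (_ == _ :> nat) (x \in A); by do 3 case=> //.
    rewrite -[2]/(1 + 1); apply: leq_add; apply: sum_pred1_le1; first exact: val_inj.
    by move=> i j [] /val_inj.
  have cF : #|F| = \sum_(x in A) \sum_(y in A) (e x y && before y x).
    rewrite -sum1_card pair_big /= big_mkcond [RHS]big_mkcond /=.
    apply: eq_bigr => -[x y] _; rewrite inE /=.
    by case: (x \in A); case: (y \in A); case: (e x y); case: (before y x).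
  have close x y : x \in A -> y \in A -> s * (e x y && before y x) <=
      tau x y + \sum_j s * [&& x \in win j, y \in win j & e x y].
    move=> xA yA; case exy: (e x y); rewrite ?muln0 //=.
    case bxy: (before y x); rewrite ?muln0 // muln1.
    have dxy : d x <= d y.
      by move: bxy => /orP[/ltnW //|/andP[/eqP -> _]].
    rewrite /tau exy mul1n.
    have [gap|gap] := leqP (d x + s) (d y).
      by have := paths2_score xA yA exy; rewrite -/d; lia.
    have dA : d x %/ s < #|A|.+1.
      rewrite ltnS (leq_trans (leq_div _ _)) // /d /score -sum1_card.
      by apply: leq_sum => z _; case: (e x z).
    rewrite (bigD1 (Ordinal dA)) //= !inE xA yA /= eqxx /= andbT.
    have -> : (d y %/ s == d x %/ s) || (d y %/ s == (d x %/ s).+1).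
      have h1 : d x %/ s <= d y %/ s by apply: leq_div2r.
      have h2 : d y %/ s <= (d x %/ s).+1.
        by have := leq_div2r s (ltnW gap); rewrite divnDr ?dvdnn // divnn s0 addn1.
      by move: h1 h2; case: ltngtP; lia.
    by rewrite muln1; lia.
  have inw j : s * (\sum_(x in A) \sum_(y in A)
       [&& x \in win j, y \in win j & e x y]) <= 7 * (s * s) * #|win j| +
       \sum_(x in A) \sum_(y in A) (x \in win j) * tau x y.
    have -> : \sum_(x in A) \sum_(y in A) [&& x \in win j, y \in win j & e x y]
        = \sum_(x in win j) score (win j) x.
      rewrite [RHS](sum_sub _ (winA j)); apply: eq_bigr => x xA.
      rewrite /score (sum_sub _ (winA j)) big_distrr; apply: eq_bigr => y yA /=.
      by case: (x \in win j); case: (y \in win j); case: (e x y).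
    apply: leq_trans (concentrated_scores_edges s0 (winA j) _) _.
      move=> x y; rewrite !inE => /andP[xA xj] /andP[yA yj].
      rewrite -/d; have := ltn_pmod (d x) s0.
      have := divn_eq (d x) s; have := divn_eq (d y) s.
      by case/orP: xj => /eqP ->; case/orP: yj => /eqP ->; nia.
    rewrite leq_add2l [X in X <= _](sum_sub _ (winA j)); apply: leq_sum => x xA.
    rewrite (sum_sub _ (winA j)) -big_distrr leq_mul2l.
    by apply/orP; right; apply: leq_sum => y yA; case: (y \in win j); rewrite ?mul1n.
  have tauE : \sum_(x in A) \sum_(y in A) tau x y = cyclic_triples A by [].
  rewrite cF big_distrr /=.
  apply: (@leq_trans (cyclic_triples A + \sum_j s * (\sum_(x in A) \sum_(y in A)
       [&& x \in win j, y \in win j & e x y]))).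
    have -> : \sum_j s * (\sum_(x in A) \sum_(y in A)
         [&& x \in win j, y \in win j & e x y]) =
      \sum_(x in A) \sum_(y in A) \sum_j
         s * [&& x \in win j, y \in win j & e x y].
      rewrite (eq_bigr (fun j => \sum_(x in A) \sum_(y in A)
         s * [&& x \in win j, y \in win j & e x y])); last first.
        move=> j _; rewrite big_distrr; apply: eq_bigr => x _.
        by rewrite big_distrr.
      rewrite exchange_big; apply: eq_bigr => x _ /=; exact: exchange_big.
    rewrite -tauE -big_split /=; apply: leq_sum => x xA.
    rewrite big_distrr -big_split /=; apply: leq_sum => y yA; exact: close.
  (* One share of the cyclic triples pays for backward edges with a large gap. The other two shares,
     and the doubling of 7 to 14, come from each vertex lying in at most two windows. *)
  have -> : 3 * cyclic_triples A + 14 * (s * s) * #|A| =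
    cyclic_triples A + (7 * (s * s) * (2 * #|A|) + 2 * cyclic_triples A) by lia.
  rewrite leq_add2l; apply: (@leq_trans (\sum_j (7 * (s * s) * #|win j| +
      \sum_(x in A) \sum_(y in A) (x \in win j) * tau x y))).
    by apply: leq_sum => j _; exact: inw.
  rewrite big_split leq_add //=.
    rewrite -big_distrr leq_mul2l /=; apply/orP; right.
    rewrite (eq_bigr (fun j => \sum_(x in A) (x \in win j))); last first.
      move=> j _; rewrite -sum1_card (sum_sub _ (winA j)).
      by apply: eq_bigr => x _; rewrite muln1.
    rewrite exchange_big mulnC -sum_nat_const; apply: leq_sum => x _; exact: win2.
  rewrite exchange_big -tauE big_distrr /=; apply: leq_sum => x xA.
  rewrite exchange_big big_distrr /=; apply: leq_sum => y yA.
  by rewrite -big_distrl leq_mul2r win2 orbT.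
have rev x y : x \in A -> y \in A ->
    reverse_edges e [set p | [&& p.1 \in A, p.2 \in A, e p.1 p.2 & before p.2 p.1]] x y
    = before x y.
  move=> xA yA; rewrite /reverse_edges !inE /= xA yA /=.
  have [-> | nxy] := eqVneq x y.
    by rewrite tournament_irr /before eqxx !ltnn.
  have nr : enum_rank x != enum_rank y by rewrite (inj_eq enum_rank_inj).
  have -> : before y x = ~~ before x y.
    move: nr; rewrite /before -(inj_eq val_inj) /=.
    by case: (ltngtP (d x) (d y)) => //= _; case: ltngtP.
  by rewrite (tournamentN nxy); case: (e x y); case: (before x y).
move=> y x z yA xA zA; rewrite !rev //; rewrite /before.
case: (ltngtP (d x) (d y)) => //= dxy; case: (ltngtP (d y) (d z)) => //= dyz.
- by rewrite (ltn_trans dyz dxy).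
- by rewrite -dyz dxy.
- by rewrite dxy dyz.
- by rewrite dxy dyz ltnn eqxx /=; exact: ltn_trans.
Qed.

(** Contrapositive: with few cyclic triangles, [feedback_set] at the best scale [s], of order
    [eps * #|A|], reverses few enough edges to make [A] transitive. *)
Lemma cyclic_triples_ge (R : realType) (eps : R) (A : {set V}) :
  (0 < eps)%R -> (200 <= eps * #|A|%:R)%R -> (eps < 1)%R ->
  ~ eps_transitive eps e A ->
  (eps ^+ 2 / 2 ^+ 11 * #|A|%:R ^+ 3 <= (cyclic_triples A)%:R)%R.
Proof.
move=> eps0 bigA eps1 neT; rewrite leNgt; apply/negP => few; apply: neT.
have pow11 : (2 ^+ 11 = 2048 :> R)%R by lra.
rewrite {}pow11 in few.
set a : R := (#|A|%:R)%R in bigA few *.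
have eps2 : (2 <= eps * a / 100)%R by lra.
have a0 : (200 <= a)%R by nra.
(* Since [eps * a / 100] is at least 2, rounding down loses at most a factor 2. *)
pose s := Num.truncn (eps * a / 100)%R.
have /andP[sle slt] : (s%:R <= eps * a / 100 < s.+1%:R)%R.
  by apply: truncn_itv; apply: divr_ge0; nra.
have s1 : (1 <= s%:R :> R)%R.
  by rewrite ler1n lt0n; apply/eqP => s0; move: slt; rewrite -(natr1 s) s0; lra.
have sge : (eps * a / 200 <= s%:R)%R by move: slt; rewrite -(natr1 s); lra.
have [F [sFA cF trF]] := feedback_set A (s := s) ltac:(by rewrite -(ler_nat R)).
exists F; split=> //.
have C2 : ('C(#|A|, 2)%:R * 2 = a * (a - 1) :> R)%R.
  have -> : (a - 1 = (#|A|.-1)%:R :> R)%R.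
    by rewrite -subn1 natrB // -(ler_nat R); move: a0; rewrite /a; lra.
  by rewrite -!natrM mulnC -mul_bin_diag bin1.
have {}cF : (s%:R * #|F|%:R <= 3 * (cyclic_triples A)%:R + 14 * (s%:R * s%:R) * a :> R)%R.
  by move: cF; rewrite -(ler_nat R) natrD !natrM.
set c : R := ((cyclic_triples A)%:R)%R in cF few.
set f : R := (#|F|%:R)%R in cF *.
(* Of the 44 hundredths, 30 come from the cyclic triples and 14 from the term in [s * s]. As [a] is
   at least 200, [44 / 100 * a ^+ 2] is below the binomial coefficient. *)
have : (s%:R * f <= s%:R * (eps * a ^+ 2 * (44 / 100)))%R.
  apply: (le_trans cF).
  have h1 : (c <= eps * a^+ 2 / 10 * (eps * a / 200))%R.
    have : (0 <= eps ^+ 2 * a ^+ 3)%R by rewrite mulr_ge0 ?exprn_ge0 // ltW.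
    lra.
  have h2 : (eps * a^+ 2 / 10 * (eps * a / 200) <= eps * a^+ 2 / 10 * s%:R)%R.
    by rewrite ler_wpM2l //; nra.
  have h3 : (s%:R * a * s%:R <= s%:R * a * (eps * a / 100))%R.
    by rewrite ler_wpM2l //; nra.
  lra.
rewrite ler_pM2l; last lra.
move=> /le_trans; apply.
have -> : ('C(#|A|, 2)%:R = a * (a - 1) / 2 :> R)%R by lra.
have : (0 <= eps * (a * (a - 200)))%R by rewrite !mulr_ge0 //; lra.
lra.
Qed.

(** Transitivity is phrased as the absence of cyclic triangles because containers use it that way: a
    chosen edge excludes every vertex closing a cyclic triangle with it. *)
Definition acyclic (A : {set V}) : bool :=
  [forall x in A, forall y in A, forall z in A, ~~ [&& e x y, e y z & e z x]].

Lemma acyclicP (A : {set V}) :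
  reflect (transitive_on e A) (acyclic A).
Proof.
apply: (iffP idP) => [acA | trA].
  move=> y x z yA xA zA exy eyz.
  have := acA; move=> /forall_inP/(_ x xA)/forall_inP/(_ y yA)/forall_inP/(_ z zA).
  rewrite exy eyz /= => nzx.
  have nxz : z != x.
    have nxy : x != y by apply: contraTneq exy => ->; rewrite tournament_irr.
    by apply: contraTneq eyz => ->; rewrite (tournamentN nxy) exy.
  by rewrite (tournamentN nxz).
apply/forall_inP => x xA; apply/forall_inP => y yA; apply/forall_inP => z zA.
apply/negP => /and3P[exy eyz ezx].
have exz := trA y x z yA xA zA exy eyz.
have nxz : x != z by apply: contraTneq exz => ->; rewrite tournament_irr.
by move: ezx; rewrite (tournamentN nxz) exz.
Qed.

Lemma acyclic_sub (A B : {set V}) : A \subset B -> acyclic B -> acyclic A.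
Proof.
move=> /subsetP sAB /acyclicP trB; apply/acyclicP => y x z yA xA zA.
by apply: trB; exact: sAB.
Qed.

End Scores.

(** * Weighted counts of vertex subsets *)

Section WeightedCount.
Variables (R : realType) (V : finType).
Implicit Types (A B X : {set V}) (P : pred {set V}) (lam : R).

(** The generating polynomial by size of the subsets of [A] satisfying [P]. Each vertex chosen in
    the container argument costs one factor [lam]. *)
Definition wcount lam P A : R :=
  \sum_(X : {set V} | (X \subset A) && P X) lam ^+ #|X|.

Lemma wcount_ge0 lam P A : 0 <= lam -> 0 <= wcount lam P A.
Proof. by move=> l0; apply: sumr_ge0 => X _; exact: exprn_ge0. Qed.

Lemma sum_subpred (I : finType) (P Q : pred I) (F : I -> R) :
  (forall i, 0 <= F i) -> (forall i, P i -> Q i) ->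
  \sum_(i | P i) F i <= \sum_(i | Q i) F i.
Proof.
move=> F0 PQ; rewrite big_mkcond [leRHS]big_mkcond; apply: ler_sum => i _.
by case: ifPn => [/PQ ->//|_]; case: ifP.
Qed.

(** A set either misses [D] or contains some [w] in [D]. Removing such a [w] costs a factor [lam]
    and leaves a set inside [B w]; then sum over [w]. *)
Lemma wcount_split lam P (Q : V -> pred {set V}) A (D : {set V}) (B : V -> {set V}) :
  0 <= lam ->
  (forall X w, X \subset A -> P X -> w \in D -> w \in X ->
     X :\ w \subset B w /\ Q w (X :\ w)) ->
  wcount lam P A <=
    wcount lam P (A :\: D) + lam * \sum_(w in D) wcount lam (Q w) (B w).
Proof.
move=> l0 PQ.
have pow0 X : 0 <= lam ^+ #|X| by exact: exprn_ge0.
have hit w : w \in D ->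
    \sum_(X : {set V} | [&& X \subset A, P X & w \in X]) lam ^+ #|X|
      <= lam * wcount lam (Q w) (B w).
  move=> wD; rewrite (reindex_onto (fun Y => w |: Y) (fun X => X :\ w)) /=; last first.
    by move=> X /and3P[_ _ wX]; exact: setD1K.
  rewrite (eq_bigr (fun Y : {set V} => lam * lam ^+ #|Y|)); last first.
    move=> Y /andP[_ /eqP YE]; rewrite cardsU1.
    have -> : w \notin Y by rewrite -YE !inE eqxx.
    by rewrite exprS.
  rewrite -big_distrr /=; apply: ler_wpM2l => //; apply: sum_subpred => // Y.
  move=> /andP[/and3P[sA PY wY] /eqP YE].
  by have := PQ _ _ sA PY wD wY; rewrite YE => -[-> ->].
rewrite big_distrr /=; apply: le_trans; last first.
  by apply: lerD (lexx _) _; apply: ler_sum => w wD; exact: hit wD.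
rewrite /wcount (bigID (fun X : {set V} => X \subset A :\: D)) /=.
apply: lerD.
  by apply: sum_subpred => // X /andP[/andP[_ ->] ->].
under [leRHS]eq_bigr do rewrite big_mkcond.
rewrite exchange_big /= big_mkcond; apply: ler_sum => X _.
case: ifP => [|_]; last by apply: sumr_ge0 => w _; case: ifP.
move=> /andP[/andP[sXA PX] nsX].
have [w wX wD] : exists2 w, w \in X & w \in D.
  move: nsX => /subsetPn[w wX]; rewrite inE (subsetP sXA _ wX) andbT negbK.
  by exists w.
rewrite (bigD1 w) //= sXA PX wX ler_wpDr //.
by apply: sumr_ge0 => x _; case: ifP.
Qed.

(** Expand a product over all vertices with factor [p] on [S], [p + q] on the rest of [A], and 1
    outside [A]. The case [q = 1] counts weighted subsets; [q = 1 - p] is the law of a random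
    subset. *)
Lemma sum_between (p q : R) (S A : {set V}) : S \subset A ->
  \sum_(U : {set V} | (S \subset U) && (U \subset A)) p ^+ #|U| * q ^+ #|A :\: U|
    = p ^+ #|S| * (p + q) ^+ #|A :\: S|.
Proof.
move=> sSA.
pose F i := if i \in A then p else 0.
pose G i := if i \in S then 0 else if i \in A then q else 1.
transitivity (\prod_i (F i + G i)); last first.
  rewrite (bigID (mem S)) /=; congr (_ * _).
    rewrite -prodr_const; apply: eq_bigr => i iS.
    by rewrite /F /G iS (subsetP sSA _ iS) addr0.
  rewrite -prodr_const [RHS]big_mkcond [LHS]big_mkcond.
  apply: eq_bigr => i _; rewrite !inE /F /G.
  by case: (i \in S) => //=; case: (i \in A); rewrite // add0r.
rewrite bigA_distr [RHS](bigID (fun U : {set V} => (S \subset U) && (U \subset A))) /=.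
rewrite [X in _ = _ + X]big1 ?addr0 => [|U]; last first.
  rewrite negb_and => /orP[] /subsetPn[x xi xU].
    by rewrite (bigD1 x) //= (negPf xU) /G xi mul0r.
  by rewrite (bigD1 x) //= xi /F (negPf xU) mul0r.
apply: eq_bigr => U /andP[sSU sUA].
rewrite [RHS](bigID (mem U)) /=; congr (_ * _).
  rewrite -prodr_const; apply: eq_bigr => i iU.
  by rewrite iU /F (subsetP sUA _ iU).
rewrite -prodr_const big_mkcond [RHS]big_mkcond; apply: eq_bigr => i _.
rewrite inE; case: (boolP (i \in U)) => //= niU.
by rewrite /G; case: (boolP (i \in S)) => // /(subsetP sSU); rewrite (negPf niU).
Qed.

Lemma wcount_le lam P A : 0 <= lam -> wcount lam P A <= expR (lam * #|A|%:R).
Proof.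
move=> l0; apply: (@le_trans _ _ ((lam + 1) ^+ #|A|)).
  have := @sum_between lam 1 set0 A (sub0set A).
  rewrite cards0 mul1r setD0 => <-; under [leRHS]eq_bigr do rewrite expr1n mulr1.
  by apply: sum_subpred => [X|X /andP[-> _]]; rewrite ?sub0set //; exact: exprn_ge0.
rewrite expRM_natr lerXn2r ?nnegrE ?expR_ge0 ?addr_ge0 //.
by rewrite addrC expR_ge1Dx.
Qed.

(** Reverse Markov inequality: vertices with [g] below [eta * M] carry at most half of the assumed
    lower bound. *)
Lemma averaging A (g : V -> R) (M eta : R) :
  0 <= eta -> 0 < M -> (forall x, x \in A -> g x <= M) ->
  2 * eta * #|A|%:R * M <= \sum_(x in A) g x ->
  eta * #|A|%:R <= #|[set x in A | eta * M <= g x]|%:R.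
Proof.
move=> eta0 M0 gM ge; set D := [set x in A | _].
have : \sum_(x in A) g x <= #|D|%:R * M + #|A|%:R * (eta * M).
  rewrite (bigID (mem D)) /=; apply: lerD.
    rewrite (eq_bigl (fun x => x \in D)); last first.
      by move=> x; apply: andb_idl; rewrite inE => /andP[].
    rewrite mulr_natl -sumr_const; apply: ler_sum => x.
    by rewrite inE => /andP[xA _]; exact: gM.
  rewrite mulr_natl -sumr_const big_mkcond [leRHS]big_mkcond.
  apply: ler_sum => x _; case: (boolP (x \in A)) => //= xA.
  by rewrite inE xA /= -ltNge; case: ltP => [/ltW //|_]; rewrite mulr_ge0 // ltW.
move=> /(le_trans ge) h; rewrite -(ler_pM2r M0); lra.
Qed.
End WeightedCount.

(** * Containers for transitive sets *)

Section Containers.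
Variables (R : realType) (V : finType) (e : rel V).
Hypothesis eT : tournament e.
Implicit Types (A B X : {set V}) (lam gam : R).

Lemma paths2_le A x y : (paths2 e A x y <= #|A|)%N.
Proof. by rewrite -sum1_card; apply: leq_sum => z _; case: (_ && _). Qed.

Lemma card_setD_le A (D : {set V}) (q : R) : D \subset A ->
  q * #|A|%:R <= #|D|%:R -> #|A :\: D|%:R <= (1 - q) * #|A|%:R.
Proof.
move=> sDA; have : (#|D| + #|A :\: D| = #|A|)%N.
  by rewrite -(cardsID D A) (setIidPr sDA).
move=> /(congr1 (GRing.natmul (1 : R))); rewrite natrD; lra.
Qed.

(** Let [D] collect the [y] for which at least [gam / 4 * #|A|] vertices [z] give a cyclic triangle
    v -> y -> z -> v. A set either misses [D], or contains some [w] in [D] and so avoids all such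
    [z] for [w]; both cases shrink [A] by the factor [1 - gam / 4]. *)
Lemma wcount_link lam gam A M v : 0 <= lam -> 0 < gam ->
  gam / 2 * #|A|%:R ^+ 2 <= (\sum_(y in A) e v y * paths2 e A y v)%N%:R ->
  (forall B, #|B|%:R <= (1 - gam / 4) * #|A|%:R -> wcount lam (acyclic e) B <= M) ->
  v \in A ->
  wcount lam (fun Y => acyclic e (v |: Y)) A <= (1 + lam * #|A|%:R) * M.
Proof.
move=> l0 g0 tv HM vA.
have a0 : 0 < #|A|%:R :> R by rewrite ltr0n; apply/card_gt0P; exists v.
pose deg y : R := (e v y * paths2 e A y v)%N%:R.
have deg_le y : deg y <= #|A|%:R.
  by rewrite ler_nat; case: (e v y); rewrite ?mul1n ?paths2_le.
have cD := averaging (A := A) (g := deg) (M := #|A|%:R) (eta := gam / 4)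
  ltac:(lra) a0 (fun y _ => deg_le y) ltac:(by rewrite -natr_sum; lra).
set D := [set y in A | _] in cD.
have sDA : D \subset A by apply/subsetP => y; rewrite inE => /andP[].
pose B w := [set z in A | ~~ [&& e v w, e w z & e z v]].
have M0 : 0 <= M.
  apply: le_trans (HM set0 _); first exact: wcount_ge0.
  by rewrite cards0; apply: le_trans (card_setD_le sDA cD).
apply: le_trans (wcount_split (Q := fun _ => acyclic e) (D := D) (B := B) l0 _) _.
  move=> X w sXA acX wD wX; split; last first.
    apply: (acyclic_sub eT _ acX); apply: subset_trans (subD1set _ _) _.
    exact: subsetUr.
  apply/subsetP => z; rewrite !inE => /andP[_ zX]; rewrite (subsetP sXA _ zX) /=.
  move: acX => /forall_inP/(_ v (setU11 _ _)).
  by move=> /forall_inP/(_ w (setU1r _ wX))/forall_inP/(_ z (setU1r _ zX)).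
rewrite mulrDl mul1r -mulrA; apply: lerD.
  apply: (@le_trans _ _ (wcount lam (acyclic e) (A :\: D))).
    apply: sum_subpred => [X|X /andP[-> acX]]; first exact: exprn_ge0.
    by apply: (acyclic_sub eT _ acX); exact: subsetUr.
  by apply: HM; exact: card_setD_le.
apply: ler_wpM2l => //; apply: (@le_trans _ _ (\sum_(w in D) M)).
  apply: ler_sum => w; rewrite inE => /andP[_ degw]; apply: HM.
  have : (#|B w| + e v w * paths2 e A w v = #|A|)%N.
    rewrite -!sum1_card big_distrr /= [RHS](bigID (fun z => z \in B w)) /=.
    congr (_ + _)%N.
      by apply: eq_bigl => z; rewrite inE; case: (z \in A).
    rewrite [RHS]big_mkcond [LHS]big_mkcond; apply: eq_bigr => z _; rewrite inE.
    by case: (z \in A) => //; case: (e v w); case: (e w z); case: (e z v).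
  move=> /(congr1 (GRing.natmul (1 : R))); rewrite natrD -/(deg w); lra.
rewrite sumr_const -[M *+ _]mulr_natl ler_wpM2r // ler_nat; exact: subset_leq_card.
Qed.

(* D is the set of vertices in many cyclic triples: an acyclic X either misses D,
   or contains some v in D, and then X is independent in the dense link graph
   of v. *)
Lemma wcount_step lam gam A M : 0 <= lam -> 0 < gam -> (0 < #|A|)%N ->
  gam * #|A|%:R ^+ 3 <= (cyclic_triples e A)%:R ->
  (forall B, #|B|%:R <= (1 - gam / 4) * #|A|%:R -> wcount lam (acyclic e) B <= M) ->
  wcount lam (acyclic e) A <= (1 + lam * #|A|%:R) ^+ 2 * M.
Proof.
move=> l0 g0 A0 tri HM.
have a0 : 0 < #|A|%:R :> R by rewrite ltr0n.
pose t v : R := (\sum_(y in A) e v y * paths2 e A y v)%N%:R.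
have t_le v : t v <= #|A|%:R ^+ 2.
  rewrite -natrX ler_nat -mulnn -sum_nat_const; apply: leq_sum => y _.
  by case: (e v y); rewrite ?mul1n ?paths2_le.
have cD := averaging (A := A) (g := t) (M := #|A|%:R ^+ 2) (eta := gam / 2)
  ltac:(lra) ltac:(by rewrite exprn_gt0) (fun y _ => t_le y)
  ltac:(by rewrite -natr_sum; move: tri; rewrite /cyclic_triples; lra).
set D := [set y in A | _] in cD.
have sDA : D \subset A by apply/subsetP => y; rewrite inE => /andP[].
have cAD : #|A :\: D|%:R <= (1 - gam / 4) * #|A|%:R :> R.
  by apply: card_setD_le => //; apply: le_trans cD; rewrite ler_pM2r //; lra.
have M0 : 0 <= M.
  apply: le_trans (HM set0 _); first exact: wcount_ge0.
  by rewrite cards0; apply: le_trans cAD.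
apply: le_trans (wcount_split (Q := fun v Y => acyclic e (v |: Y)) (D := D)
  (B := fun=> A) l0 _) _.
  move=> X w sXA acX wD wX; rewrite setD1K //; split => //.
  exact: subset_trans (subD1set _ _) sXA.
(* With [u = lam * #|A|], the two cases add up to [1 + u * (1 + u)] times [M], at most
   [(1 + u) ^+ 2] times [M]. *)
apply: (@le_trans _ _ (M + lam * (#|A|%:R * ((1 + lam * #|A|%:R) * M)))).
  apply: lerD; first exact: HM.
  apply: ler_wpM2l => //.
  have L0 : 0 <= (1 + lam * #|A|%:R) * M by rewrite mulr_ge0 // addr_ge0 // mulr_ge0.
  apply: (@le_trans _ _ (\sum_(w in D) ((1 + lam * #|A|%:R) * M))).
    apply: ler_sum => w; rewrite inE => /andP[wA tw]; exact: (wcount_link (gam := gam)).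
  by rewrite sumr_const -[_ *+ #|D|]mulr_natl ler_wpM2r // ler_nat subset_leq_card.
have : 0 <= lam * #|A|%:R * M by rewrite !mulr_ge0 // ltW.
lra.
Qed.

(** Each round shrinks the ambient set by [1 - gam / 4] at the cost of two choices. Once the size is
    at most [beta], all subsets are counted, with total weight at most [expR (lam * beta)]. *)
Lemma wcount_iter lam gam (beta : R) m A :
  0 <= lam -> 0 < gam -> gam < 4 -> 0 < beta ->
  (forall B, beta < #|B|%:R -> gam * #|B|%:R ^+ 3 <= (cyclic_triples e B)%:R) ->
  #|A|%:R * (1 - gam / 4) ^+ m <= beta ->
  wcount lam (acyclic e) A <= (1 + lam * #|V|%:R) ^+ (2 * m) * expR (lam * beta).
Proof.
move=> l0 g0 g4 b0 dense.
have q1 : 1 <= 1 + lam * #|V|%:R by rewrite lerDl mulr_ge0.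
have small B j : #|B|%:R <= beta ->
    wcount lam (acyclic e) B <= (1 + lam * #|V|%:R) ^+ j * expR (lam * beta).
  move=> Bb; apply: le_trans (wcount_le _ _ l0) _.
  apply: (@le_trans _ _ (expR (lam * beta))); first by rewrite ler_expR ler_wpM2l.
  by rewrite ler_peMl ?expR_ge0 // exprn_ege1.
elim: m A => [|m IH] A; first by rewrite mulr1; exact: small.
have [/small Ab _|Ab Am] := leP #|A|%:R beta; first exact: Ab.
rewrite mulnS exprD -mulrA.
have A0 : (0 < #|A|)%N by rewrite -(ltr_nat R) (lt_trans b0).
have lV : 1 + lam * #|A|%:R <= 1 + lam * #|V|%:R.
  by rewrite lerD2l ler_wpM2l // ler_nat max_card.
apply: (@le_trans _ _ ((1 + lam * #|A|%:R) ^+ 2 *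
    ((1 + lam * #|V|%:R) ^+ (2 * m) * expR (lam * beta)))).
  apply: (wcount_step l0 g0 A0 (dense _ Ab)) => B cB; apply: IH.
  apply: le_trans Am; rewrite exprS mulrA ler_wpM2r ?exprn_ge0 //; first by lra.
  by rewrite mulrC.
apply: ler_wpM2r; first by rewrite mulr_ge0 ?expR_ge0 // exprn_ge0 // (le_trans _ q1).
by rewrite lerXn2r // nnegrE addr_ge0 // mulr_ge0.
Qed.
End Containers.

(** * Deletion and random sampling *)

Lemma hitting_set (V : finType) (F : {set {set V}}) : set0 \notin F ->
  exists2 H : {set V}, (#|H| <= #|F|)%N & {in F, forall S, S :&: H != set0}.
Proof.
move=> F0; have [->|[S0 S0F]] := set_0Vmem F.
  by exists set0 => [|S]; rewrite ?cards0 // inE.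
have /set0Pn[x0 _] : S0 != set0 by apply: contraNneq F0 => <-.
(* The default [x0] only makes the choice total: no member of [F] is empty. *)
exists ((fun S : {set V} => odflt x0 [pick x in S]) @: F); first exact: leq_imset_card.
move=> S SF; have /set0Pn[x xS] : S != set0 by apply: contraNneq F0 => <-.
apply/set0Pn; case pk : [pick x in S] => [y|]; last first.
  by move: pk; case: pickP => // /(_ x); rewrite xS.
exists y; rewrite inE; apply/andP; split.
  by move: pk; case: pickP => // z zS [<-].
by apply/imsetP; exists S; rewrite ?pk.
Qed.

Section Sampling.
Variables (R : realType) (f : R -> R) (W V : finType) (T : rel W) (e : rel V).
Hypotheses (TEH : erdos_hajnal f T) (eT : tournament e).

Lemma card_copy (S : {set V}) : is_copy T e S -> #|S| = #|W|.
Proof.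
move=> /existsP[phi /and3P[/injectiveP phi_inj /eqP <- _]].
by rewrite card_imset ?cardsT.
Qed.

Lemma erdos_hajnal_on (k : R) (U : {set V}) :
  1 <= k -> k `^ f k <= #|U|%:R ->
  (forall S : {set V}, S \subset U -> ~~ is_copy T e S) ->
  exists S : {set V}, [/\ S \subset U, k <= #|S|%:R & acyclic e S].
Proof.
move=> k1 kU freeU.
pose eU : rel {x | x \in U} := fun x y => e (val x) (val y).
have eUT : tournament eU.
  split=> [x|x y nxy]; first exact: (tournament_irr eT).
  by apply: (tournamentN eT); rewrite (inj_eq val_inj) eq_sym.
have [||S [kS trS]] := TEH k1 eUT.
- move=> S; apply/negP => /existsP[phi].
  move=> /and3P[/injectiveP phi_inj /eqP phiS /forallP phiT].
  have sSU : val @: S \subset U.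
    by apply/subsetP => _ /imsetP[x _ ->]; exact: valP.
  have /negP[] := freeU _ sSU.
  apply/existsP; exists [ffun w => val (phi w)]; apply/and3P; split.
  + by apply/injectiveP => x y; rewrite !ffunE => /val_inj/phi_inj.
  + rewrite -phiS -imset_comp; apply/eqP/eq_imset => w; exact: ffunE.
  + apply/forallP => x; apply/forallP => y; rewrite !ffunE.
    by have /forallP := phiT x; exact.
- by rewrite card_sig.
exists (val @: S); split.
- by apply/subsetP => _ /imsetP[x _ ->]; exact: valP.
- by rewrite card_imset //; exact: val_inj.
apply/(acyclicP eT) => _ _ _ /imsetP[y yS ->] /imsetP[x xS ->] /imsetP[z zS ->].
exact: trS.
Qed.

(** After deleting a hitting set, what remains of [U] contains neither a copy of [T] nor a
    transitive set of size [k], so the Erdős-Hajnal property caps its size. Both families avoid the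
    empty set, by [0 < #|W|] and [1 <= k]. *)
Lemma deletion_bound (k : R) (U : {set V}) : (0 < #|W|)%N -> 1 <= k ->
  #|U|%:R <= #|[set S | is_copy T e S && (S \subset U)]|%:R
    + #|[set X | [&& acyclic e X, k <= #|X|%:R & X \subset U]]|%:R + k `^ f k.
Proof.
move=> W0 k1; set F1 := [set S | _]; set F2 := [set X | _].
have [|H cH hitH] := @hitting_set V (F1 :|: F2).
  apply/negP; rewrite !inE sub0set !andbT => /orP[/card_copy|/andP[_]].
    by move=> c0; move: W0; rewrite -c0 cards0.
  by rewrite cards0; lra.
have {}hitH (S : {set V}) : S \subset U -> S :&: H = set0 -> S \notin F1 :|: F2.
  by move=> _ S0; apply/negP => /hitH; rewrite S0 eqxx.
have disj (S : {set V}) : S \subset U :\: H -> S :&: H = set0.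
  by rewrite subsetD => /andP[_]; rewrite -setI_eq0 => /eqP.
have UH : #|U|%:R <= #|U :\: H|%:R + #|F1|%:R + #|F2|%:R :> R.
  rewrite -!natrD ler_nat -(cardsID H U) addnC -addnA leq_add2l.
  apply: leq_trans (leq_trans cH _); first exact: subset_leq_card (subsetIr _ _).
  by rewrite cardsU leq_subr.
suff : #|U :\: H|%:R <= k `^ f k by lra.
rewrite leNgt; apply/negP => /ltW /(erdos_hajnal_on k1)[].
  move=> S sS; have sSU := subset_trans sS (subsetDl _ _).
  by have := hitH S sSU (disj S sS); rewrite !inE sSU andbT negb_or => /andP[].
move=> S [sS kS acS]; have sSU := subset_trans sS (subsetDl _ _).
by have := hitH S sSU (disj S sS); rewrite !inE sSU acS kS orbT.
Qed.

(** Linearity of expectation for a random [U] that keeps each vertex independently with probability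
    [p]. *)
Lemma expected_count (p : R) (P : pred {set V}) :
  \sum_(U : {set V}) p ^+ #|U| * (1 - p) ^+ #|~: U|
      * #|[set S | P S && (S \subset U)]|%:R
    = \sum_(S : {set V} | P S) p ^+ #|S|.
Proof.
have one (S : {set V}) :
    \sum_(U : {set V} | S \subset U) p ^+ #|U| * (1 - p) ^+ #|~: U| = p ^+ #|S|.
  have := sum_between p (1 - p) (subsetT S).
  rewrite addrCA subrr addr0 expr1n mulr1 => <-.
  by apply: eq_big => U; rewrite ?subsetT ?andbT // => _; rewrite setTD.
under [RHS]eq_bigr do rewrite -one.
rewrite (exchange_big_dep xpredT) //=; apply: eq_bigr => U _.
rewrite sumr_const mulr_natr; congr (_ *+ _); apply: eq_card => S.
by rewrite inE.
Qed.

(** The expectation of [deletion_bound] over a random [U]. *)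
Lemma sampling_bound (k p : R) : (0 < #|W|)%N -> 1 <= k -> 0 <= p <= 1 ->
  p * #|V|%:R <= (num_copies T e)%:R * p ^+ #|W|
    + \sum_(X : {set V} | acyclic e X && (k <= #|X|%:R)) p ^+ #|X| + k `^ f k.
Proof.
move=> W0 k1 /andP[p0 p1].
pose w (U : {set V}) := p ^+ #|U| * (1 - p) ^+ #|~: U|.
have w0 U : 0 <= w U by rewrite mulr_ge0 ?exprn_ge0 // subr_ge0.
have w1 : \sum_U w U = 1.
  have := sum_between p (1 - p) (sub0set [set: V]).
  rewrite cards0 mul1r addrCA subrr addr0 expr1n => <-.
  by apply: eq_big => U; rewrite ?sub0set ?subsetT // => _; rewrite setTD.
have <- : \sum_U w U * #|U|%:R = p * #|V|%:R.
  (* The size of [U] is the number of singletons inside it, so [expected_count] applies. *)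
  rewrite (eq_bigr (fun U => w U *
      #|[set S : {set V} | (#|S| == 1%N) && (S \subset U)]|%:R)).
    rewrite expected_count (eq_bigr (fun=> p)); last by move=> S /eqP ->.
    by rewrite sumr_const mulr_natr -cardsE card_draws bin1.
  move=> U _; congr (_ * _%:R); rewrite -[LHS]bin1 -cards_draws.
  by apply: eq_card => S; rewrite !inE andbC.
have <- : \sum_U w U * #|[set S | is_copy T e S && (S \subset U)]|%:R
    = (num_copies T e)%:R * p ^+ #|W|.
  rewrite expected_count (eq_bigr (fun=> p ^+ #|W|)); last by move=> S /card_copy ->.
  rewrite sumr_const mulr_natl; congr (_ *+ _); apply: eq_card => S; by rewrite inE.
have -> : k `^ f k = \sum_U w U * k `^ f k by rewrite -big_distrl /= w1 mul1r.
rewrite -expected_count -!big_split /=.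
apply: ler_sum => U _; rewrite -/(w U) -!mulrDr; apply: ler_wpM2l; first exact: w0.
have := deletion_bound U W0 k1; congr (_ <= _ + #|pred_of_set _|%:R + _).
by apply/setP => X; rewrite !inE andbA.
Qed.
End Sampling.

(** * Degenerate cases *)

(** Every map from at most one vertex is an embedding determined by its image. This excludes
    [h <= 1], where the hypothesis asks for fewer than [n ^ h] copies. *)
Lemma num_copies_small (W V : finType) (T : rel W) (e : rel V) :
  tournament T -> tournament e -> (#|W| <= 1)%N -> (#|V| ^ #|W| <= num_copies T e)%N.
Proof.
move=> TT eT W1.
have W_eq (x y : W) : x = y.
  by move/card_le1P: W1 => /(_ x isT y); rewrite !inE => /esym/eqP.
have copy (phi : {ffun W -> V}) : is_copy T e (phi @: [set: W]).
  apply/existsP; exists phi; rewrite eqxx /=; apply/andP; split.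
    by apply/injectiveP.
  apply/forallP => x; apply/forallP => y.
  by rewrite (W_eq x y) (tournament_irr TT) (tournament_irr eT).
rewrite -card_ffun -cardsT.
have inj : injective (fun phi : {ffun W -> V} => phi @: [set: W]).
  move=> phi psi eq_im; apply/ffunP => x.
  have : phi x \in psi @: [set: W] by rewrite -eq_im imset_f.
  by case/imsetP => y _ ->; rewrite (W_eq y x).
rewrite -(card_imset _ inj); apply: subset_leq_card; apply/subsetP => _ /imsetP[phi _ ->].
by rewrite inE.
Qed.

Lemma acyclic_eps_transitive (R : realType) (eps : R) (V : finType) (e : rel V)
    (S : {set V}) : tournament e -> 0 <= eps -> acyclic e S -> eps_transitive eps e S.
Proof.
move=> eT eps0 /(acyclicP eT) trS; exists set0; split.
- exact: sub0set.
- by rewrite cards0 mulr_ge0.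
- move=> y x z yS xS zS; rewrite /reverse_edges !inE /=; exact: trS.
Qed.

(** * Numerical estimates *)

Section Analysis.
Variable R : realType.
Implicit Types (eps k n s : R).

(** The expected number of copies in a sample is below [n * s] times the power [h - 1] of
    [dk * (n * s)], and [1 < h] leaves at least one factor [1 / 4]. Deletion without sampling is the
    case [s = 1]. *)
Lemma few_copies (N dk n s : R) h : (1 < h)%N -> 0 <= dk -> 0 <= n -> 0 <= s ->
  dk * (n * s) <= 1 / 4 -> N < dk ^+ (h - 1) * n ^+ h -> N * s ^+ h <= n * s / 4.
Proof.
case: h => [//|[//|h]] _ dk0 n0 s0 small; rewrite subSS subn0 => ltN.
apply: (@le_trans _ _ (dk ^+ h.+1 * n ^+ h.+2 * s ^+ h.+2)).
  by apply: ler_wpM2r; [exact: exprn_ge0|exact: ltW].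
have -> : dk ^+ h.+1 * n ^+ h.+2 * s ^+ h.+2
    = n * s * (dk * (n * s) * (dk * (n * s)) ^+ h).
  by rewrite !exprMn !exprS; ring.
apply: ler_wpM2l; first exact: mulr_ge0.
have d0 : 0 <= dk * (n * s) by rewrite !mulr_ge0.
have : (dk * (n * s)) ^+ h <= 1 by apply: exprn_ile1 => //; lra.
have := exprn_ge0 h d0; nra.
Qed.

Lemma expR2_le16 : expR 2 <= 16 :> R.
Proof.
have h : expR (2^-1) <= 2 :> R.
  have := expR_ge1Dx (- 2^-1 : R); rewrite expRN => h.
  have e0 := expR_gt0 (2^-1 : R).
  have : (1 + - 2^-1) * expR 2^-1 <= 1 :> R by rewrite -ler_pdivlMr // div1r.
  lra.
have -> : 2 = 2^-1 * 4%:R :> R by lra.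
rewrite expRM_natr; apply: (@le_trans _ _ (2 ^+ 4)); last by lra.
by rewrite lerXn2r ?nnegrE ?expR_ge0.
Qed.

Lemma expR2_ge3 : 3 <= expR 2 :> R.
Proof. by have := expR_ge1Dx (2 : R); lra. Qed.

Lemma ln_le_subr1 x : 0 < x -> ln x <= x - 1 :> R.
Proof.
by move=> x0; have := @le_ln1Dx R (x - 1); rewrite addrCA subrr addr0; apply; lra.
Qed.

Lemma pow2_natr m : exists N : nat, 2 ^+ m = N%:R :> R.
Proof. by exists (2 ^ m)%N; rewrite natrX. Qed.

(** How the constant is spent: [32 ^+ 4] pays for the bound of [ln k] by [32 * ln (1 / eps)], the 16
    makes [k] at least [expR 2], and [2 ^+ 16] is the margin kept for later. *)
Lemma pow2_40 : 2 ^+ 40 = 2 ^+ 16 * 32 ^+ 4 * 16 :> R.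
Proof.
have -> : 32 = 2 ^+ 5 :> R by lra.
have -> : 16 = 2 ^+ 4 :> R by lra.
by rewrite -exprM -!exprD.
Qed.

Lemma k_estimates eps k : 0 < eps -> eps < 1 / 100 ->
  k = 2 ^+ 40 * (Num.ceil (1 / eps ^+ 2 * ln (1 / eps) ^+ 4))%:~R ->
  [/\ exists K : nat, k = K%:R, 2 ^+ 16 / eps ^+ 2 <= k, 2 <= ln k
    & 2 ^+ 16 * (ln k ^+ 4 / eps ^+ 2) <= k].
Proof.
move=> eps0 eps1; set x := 1 / eps ^+ 2 * _.
have lnC : ln (2 ^+ 40 : R) <= 40.
  rewrite lnXn //; have := @ln_le_subr1 2 ltac:(lra).
  by rewrite -[_ *+ 40]mulr_natr; lra.
have [N NE] := pow2_natr 40.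
have CE := pow2_40.
have A1 : 1 <= 2 ^+ 16 :> R by rewrite exprn_ege1 //; lra.
move: (2 ^+ 16 : R) A1 CE => A A1 CE.
move: (2 ^+ 40 : R) lnC NE CE => C lnC NE CE kE.
have C_ge : A * 16 <= C by rewrite CE; nra.
have C0 : 0 < C by lra.
pose l := ln (1 / eps).
have ie0 : 0 < 1 / eps by rewrite divr_gt0.
have ie100 : 100 < 1 / eps by rewrite ltr_pdivlMr //; lra.
(* [expR 3] is the sixth power of [expR 2^-1], hence at most 64, while [1 / eps] exceeds 100. *)
have l3 : 3 <= l.
  rewrite -(expRK 3) /l ler_ln ?posrE ?expR_gt0 //.
  have e2 : expR 2^-1 ^+ 4 = expR 2 :> R by rewrite -expRM_natr; congr expR; lra.
  have e20 := expR_gt0 (2^-1 : R).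
  have h : expR 2^-1 <= 2 :> R.
    rewrite -(@ler_pXn2r _ 4) ?nnegrE //; last exact: ltW.
    by rewrite e2 (le_trans expR2_le16) //; lra.
  have -> : 3 = 2^-1 * 6%:R :> R by lra.
  rewrite expRM_natr; apply: (@le_trans _ _ (2 ^+ 6)); last by lra.
  by rewrite lerXn2r // nnegrE ltW.
have e20 : 0 < eps ^+ 2 by rewrite exprn_gt0.
have xE : x = l ^+ 4 / eps ^+ 2 by rewrite /x mul1r mulrC.
have l4 : 1 <= l ^+ 4 by rewrite exprn_ege1 //; lra.
have ie2 : 1 <= (eps ^+ 2)^-1 by rewrite invf_ge1 // expr_le1 //; lra.
have x_ge : (eps ^+ 2)^-1 <= x by rewrite xE; nra.
have x1 : 1 <= x by lra.
have /andP[cx1 cx2] : x <= (Num.ceil x)%:~R <= 2 * x.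
  have := ceil_itv x; rewrite intrD => /andP[h1 ->] /=.
  by move: h1; rewrite rmorphN /=; lra.
have k_ge : C * x <= k by rewrite kE ler_pM2l.
have k_le : k <= C * (2 * x) by rewrite kE ler_pM2l.
have x0 : 0 < x by lra.
have k0 : 0 < k by apply: lt_le_trans k_ge; rewrite mulr_gt0.
have k16 : 16 <= k by apply: le_trans k_ge; nra.
split.
- exists (N * `|Num.ceil x|)%N; rewrite kE natrM NE; congr (_ * _).
  have c0 : 0 <= Num.ceil x by rewrite -(ler_int R) (le_trans _ cx1) // ltW.
  by rewrite -[in LHS](gez0_abs c0).
- apply: le_trans k_ge; apply: ler_pM => //; lra.
- rewrite -[leLHS]expRK ler_ln ?posrE ?expR_gt0 //.
  exact: (le_trans expR2_le16).
have lnk0 : 0 <= ln k by apply: ln_ge0; lra.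
(* Expanding [ln (C * (2 * x))] gives at most [37 + 6 * l], and [l] is at least 3. *)
have lnk : ln k <= 32 * l.
  have : ln k <= ln (C * (2 * x)).
    have Cx0 : 0 < C * (2 * x) by nra.
    rewrite ler_ln ?posrE //.
  have l0 : 0 < l by lra.
  rewrite xE !lnM ?posrE ?mulr_gt0 ?invr_gt0 ?exprn_gt0 //.
  rewrite lnV ?posrE // !lnXn //.
  have := @ln_le_subr1 2 ltac:(lra).
  have := @ln_le_subr1 l ltac:(lra).
  have : l = - ln eps by rewrite /l div1r lnV.
  by rewrite -[_ *+ 2]mulr_natr; lra.
have : ln k ^+ 4 <= (32 * l) ^+ 4 by rewrite lerXn2r // nnegrE; lra.
rewrite exprMn => h.
apply: le_trans k_ge; rewrite xE !mulrA ler_pM2r ?invr_gt0 // CE.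
have D0 : 0 <= 32 ^+ 4 :> R by apply: exprn_ge0.
move: (32 ^+ 4 : R) D0 h => D D0 h.
have : A * ln k ^+ 4 <= A * (D * l ^+ 4) by rewrite ler_pM2l //; lra.
have : 0 <= A * (D * l ^+ 4) by rewrite !mulr_ge0 //; lra.
lra.
Qed.
End Analysis.

(** * The weighted number of large transitive sets *)

(** Chernoff-style change of weight: a set of size at least [K] loses at least [(p / lam) ^+ K] in
    passing from weight [lam] to weight [p]. *)
Lemma sum_large_acyclic (R : realType) (V : finType) (e : rel V) (p lam k : R) (K : nat) :
  k = K%:R -> 0 <= p -> 0 < lam -> p <= lam ->
  \sum_(X : {set V} | acyclic e X && (k <= #|X|%:R)) p ^+ #|X|
    <= (p / lam) ^+ K * wcount lam (acyclic e) [set: V].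
Proof.
move=> -> p0 l0 pl; have q0 : 0 <= p / lam by rewrite divr_ge0 // ltW.
have q1 : p / lam <= 1 by rewrite ler_pdivrMr // mul1r.
rewrite big_distrr /= big_mkcond [leRHS]big_mkcond; apply: ler_sum => X _.
have rhs0 : 0 <= (p / lam) ^+ K * lam ^+ #|X| by rewrite mulr_ge0 ?exprn_ge0 // ltW.
rewrite subsetT /=; case: (acyclic e X) => //=; case: ifP => // KX.
have {1}-> : p = p / lam * lam by rewrite divfK ?gt_eqF.
rewrite exprMn ler_wpM2r ?exprn_ge0 ?(ltW l0) // ler_wiXn2l //.
by move: KX; rewrite ler_nat.
Qed.

(* A stands for 2 ^+ 16 and m for the number of container steps. *)
Lemma steps_bound (R : realType) (eps A L k d gam : R) (m : nat) :
  0 < eps -> 100 <= (eps ^+ 2)^-1 -> 200 * 200 <= A -> 2 <= L ->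
  A * (L ^+ 4 / eps ^+ 2) <= k -> d <= L ^+ 2 -> gam = eps ^+ 2 / 2 ^+ 11 ->
  m%:R <= 4 * d / gam + 1 -> 4 * m%:R * L ^+ 2 <= k.
Proof.
move=> eps0 ie2 A_ge L2 kL dL gamE m_le.
have g0 : 0 < gam by rewrite gamE divr_gt0 ?exprn_gt0.
have L4 : 2 * 2 <= L ^+ 2 by rewrite expr2; apply: ler_pM.
have L40 : 0 <= L ^+ 4 / eps ^+ 2 by rewrite divr_ge0 ?exprn_ge0 //; lra.
have dL2 : d * L ^+ 2 <= L ^+ 4.
  by rewrite -[4%N]/(2 + 2)%N exprD ler_pM2r; lra.
have E1 : d / gam * L ^+ 2 = 2 ^+ 11 * (d * L ^+ 2) / eps ^+ 2.
  by rewrite gamE; field; rewrite gt_eqF.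
have h1 : d / gam * L ^+ 2 <= 2 ^+ 11 * (L ^+ 4 / eps ^+ 2).
  have ie2_ge0 : 0 <= (eps ^+ 2)^-1 by lra.
  by rewrite E1; have := ler_wpM2r ie2_ge0 dL2; lra.
have h2 : L ^+ 2 <= L ^+ 4 / eps ^+ 2.
  rewrite -[4%N]/(2 + 2)%N exprD -mulrA -[leLHS]mulr1 ler_pM2l; last lra.
  by apply: mulr_ege1; lra.
have h3 : 4 * m%:R * L ^+ 2 <= 4 * (4 * d / gam + 1) * L ^+ 2.
  by rewrite ler_pM2r ?ler_pM2l //; lra.
(* The constants needed add up to [16 * 2 ^+ 11 + 4], below [200 * 200]. *)
have h4 : 200 * 200 * (L ^+ 4 / eps ^+ 2) <= A * (L ^+ 4 / eps ^+ 2).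
  exact: ler_wpM2r.
lra.
Qed.

(** Supplies the size hypothesis of [cyclic_triples_ge] for every set above the threshold where the
    container iteration stops. *)
Lemma eps_mul_card_ge (R : realType) (eps A k b : R) :
  0 < eps -> eps < 1 / 100 -> 200 * 200 <= A -> A / eps ^+ 2 <= k ->
  k / 32 <= b -> 200 <= eps * b.
Proof.
move=> eps0 eps1 A_ge kA kb.
have h1 : eps * (k / 32) <= eps * b by rewrite ler_pM2l.
have h2 : eps * (A / eps ^+ 2) <= eps * k by rewrite ler_pM2l.
have h3 : eps * (A / eps ^+ 2) = A / eps by field; rewrite gt_eqF.
have h4 : A * 100 <= A / eps.
  rewrite ler_pM2l; last lra.
  by rewrite -[leLHS]invrK lef_pV2 ?posrE ?invr_gt0 //; lra.
lra.
Qed.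

(** Here [1 + c * y] is the cost of one choice in the container iteration; it is at most [k * y],
    whose logarithm is [(1 + fk) * L]. *)
Lemma growth_factor_le (R : realType) (k y c L fk : R) :
  k = expR L -> y = expR (fk * L) -> k <= y -> 2 <= L -> fk <= L ->
  1 <= k -> c + 1 <= k -> 1 + c * y <= expR (2 * L ^+ 2).
Proof.
move=> kexp yexp ky L2 fkL k1 ck; apply: (@le_trans _ _ (k * y)).
  have : (c + 1) * y <= k * y by rewrite ler_pM2r //; lra.
  lra.
rewrite kexp yexp -expRD ler_expR.
have : fk * L <= L * L by rewrite ler_pM2r //; lra.
have : 2 * L <= L * L by rewrite ler_pM2r //; lra.
by rewrite expr2; lra.
Qed.

(** The container iteration costs at most [expR k] and the final sets another [expR k], while the
    change of weight gains [(4 / c) ^+ K]. With [c = 8 * expR 2] the product is a power of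
    [1 / 2]. *)
Lemma sum_transitive_le1 (R : realType) (V : finType) (e : rel V)
    (eps k fk delta c n : R) (K : nat) :
  tournament e -> n = #|V|%:R -> 0 < eps -> eps < 1 / 100 -> k = K%:R ->
  2 ^+ 16 / eps ^+ 2 <= k -> 2 <= ln k -> 2 ^+ 16 * (ln k ^+ 4 / eps ^+ 2) <= k ->
  2 <= fk -> fk <= ln k -> c = 8 * expR 2 -> delta = k / (c * k `^ fk) ->
  4 * k `^ fk <= n ->
  (forall S : {set V}, delta * n <= #|S|%:R -> ~ eps_transitive eps e S) ->
  \sum_(X : {set V} | acyclic e X && (k <= #|X|%:R)) (4 * k `^ fk / n) ^+ #|X| <= 1.
Proof.
move=> eT nE eps0 eps1 kK.
have A_ge : 200 * 200 <= 2 ^+ 16 :> R.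
  have h : 200 <= 2 ^+ 8 :> R by lra.
  have -> : 2 ^+ 16 = 2 ^+ 8 * 2 ^+ 8 :> R by rewrite -exprD.
  by apply: ler_pM.
move: (2 ^+ 16 : R) A_ge => A A_ge kA; set L := ln k => L2 kL fk2 fkL cE deltaE yn noS.
have e2_ge := expR2_ge3 R; have e2_le := expR2_le16 R.
set y := k `^ fk in deltaE yn *.
have ie2 : 100 <= (eps ^+ 2)^-1.
  rewrite -[leLHS]invrK lef_pV2 ?posrE ?exprn_gt0 ?invr_gt0 //.
  have : eps * eps <= 1 / 100 * (1 / 100) by apply: ler_pM; lra.
  by rewrite expr2; lra.
have kA' : A * 100 <= k by apply: le_trans kA; rewrite ler_pM2l; lra.
have k0 : 0 < k by lra.
have kexp : k = expR L by rewrite /L lnK.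
have yexp : y = expR (fk * L) by rewrite /y {1}kexp -expRM mulrC.
have ky : k <= y.
  by rewrite yexp {1}kexp ler_expR -[leLHS]mul1r ler_wpM2r //; lra.
have y0 : 0 < y by lra.
have c24 : 24 <= c by lra.
have c128 : c <= 128 by lra.
have c0 : 0 < c by lra.
have n0 : 0 < n by lra.
have d0 : 0 < delta by rewrite deltaE divr_gt0 ?mulr_gt0.
have dy : delta * y = k / c by rewrite deltaE invfM mulrA divfK // gt_eqF.
set beta := delta * n in noS.
have b0 : 0 < beta by rewrite mulr_gt0.
have beta_ge : k / 32 <= beta.
  have : 4 * (delta * y) <= beta by rewrite /beta mulrCA ler_pM2l.
  have : k / 128 <= k / c by rewrite ler_pM2l // lef_pV2 ?posrE.
  by rewrite dy; lra.
(* This weight makes the final factor [expR (lam * beta)] equal to [expR k] and keeps [p / lam] at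
   the constant [4 / c]. *)
have [lam lamE] : {l | l = k / beta} by exists (k / beta).
have lam0 : 0 < lam by rewrite lamE divr_gt0.
have lamn : lam * n = c * y.
  rewrite lamE /beta deltaE; field; rewrite !gt_eqF //.
have plam : 4 * y / n / lam = 4 / c.
  by rewrite lamE /beta deltaE; field; rewrite !gt_eqF.
have [gam gamE] : {g | g = eps ^+ 2 / 2 ^+ 11} by exists (eps ^+ 2 / 2 ^+ 11).
have g0 : 0 < gam by rewrite gamE divr_gt0 ?exprn_gt0.
have e21 : eps ^+ 2 <= 1 by rewrite expr_le1 //; lra.
pose d := ln (c * y / k).
have dE : d = ln c + fk * L - L.
  by rewrite /d ln_div ?posrE ?mulr_gt0 // lnM ?posrE // yexp expRK.
have dexp : delta = expR (- d).
  by rewrite expRN /d lnK ?posrE ?divr_gt0 ?mulr_gt0 // invf_div deltaE.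
clearbody d.
have dL : d <= L ^+ 2.
  have : ln c <= L by rewrite /L ler_ln ?posrE //; lra.
  have : fk * L <= L * L by rewrite ler_pM2r //; lra.
  by rewrite dE; lra.
have d_ge0 : 0 <= d.
  have : 0 <= ln c by apply: ln_ge0; lra.
  have : 1 * L <= fk * L by rewrite ler_pM2r; lra.
  by rewrite dE; lra.
(* Chosen so that [expR (- (gam / 4)) ^+ m] is at most [expR (- d) = delta]. *)
pose m := (Num.truncn (4 * d / gam)).+1.
have d4 : 0 <= 4 * d / gam by rewrite divr_ge0 ?mulr_ge0 // ltW.
have [m_le m_gt] : m%:R <= 4 * d / gam + 1 /\ 4 * d / gam < m%:R.
  have /andP[h1 h2] := truncn_itv d4; split=> //.
  by rewrite -(natr1 (Num.truncn _)) lerD2r.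
have m_bound := steps_bound eps0 ie2 A_ge L2 kL dL gamE m_le.
have Zle : wcount lam (acyclic e) [set: V] <=
    (1 + lam * #|V|%:R) ^+ (2 * m) * expR (lam * beta).
  apply: (wcount_iter eT (ltW lam0) g0 _ b0).
  - by rewrite gamE; lra.
  - move=> B Bb; rewrite gamE.
    apply: cyclic_triples_ge => //; last by apply: noS; exact: ltW.
      exact: (eps_mul_card_ge eps0 eps1 A_ge kA (le_trans beta_ge (ltW Bb))).
    lra.
  (* m steps suffice, since ln (1 / delta) = d <= L ^ 2 by f(k) <= ln k. *)
  rewrite cardsT -nE mulrC /beta ler_pM2r // dexp.
  apply: (@le_trans _ _ (expR (- (gam / 4)) ^+ m)).
    rewrite lerXn2r ?nnegrE ?expR_ge0 ?expR_ge1Dx //.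
    by rewrite gamE; lra.
  rewrite -expRM_natr ler_expR mulNr lerN2.
  have : 4 * d / gam * gam <= m%:R * gam by rewrite ler_pM2r // ltW.
  by rewrite divfK ?gt_eqF //; lra.
rewrite -nE lamn in Zle.
have cy_le : 1 + c * y <= expR (2 * L ^+ 2).
  have [k_ge1 k_gec] : 1 <= k /\ c + 1 <= k.
    by clear - A_ge kA' c128; split; lra.
  exact: growth_factor_le kexp yexp ky L2 fkL k_ge1 k_gec.
have Zk : wcount lam (acyclic e) [set: V] <= expR k * expR k.
  apply: (le_trans Zle); rewrite lamE divfK ?gt_eqF // ler_pM2r ?expR_gt0 //.
  apply: (@le_trans _ _ (expR (2 * L ^+ 2) ^+ (2 * m))).
    by rewrite lerXn2r // nnegrE ?expR_ge0 // addr_ge0 // mulr_ge0 // ltW.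
  by rewrite -expRM_natr ler_expR natrM; lra.
have p0 : 0 <= 4 * y / n by rewrite divr_ge0 ?mulr_ge0 // ltW.
have p_lam : 4 * y / n <= lam.
  by rewrite -[leRHS]mul1r -ler_pdivrMr // plam ler_pdivrMr //; lra.
apply: le_trans (sum_large_acyclic e kK p0 lam0 p_lam) _.
rewrite plam; apply: (@le_trans _ _ ((4 / c) ^+ K * (expR k * expR k))).
  by apply: ler_wpM2l => //; rewrite exprn_ge0 // divr_ge0 // ltW.
have -> : expR k * expR k = expR 2 ^+ K.
  by rewrite -expRD -expRM_natr kK; congr expR; ring.
rewrite -exprMn.
apply: exprn_ile1; first by rewrite mulr_ge0 ?expR_ge0 // divr_ge0 // ltW.
by rewrite cE mulrAC ler_pdivrMr; clear -e2_ge; lra.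
Qed.

(** * Choice of constants and the two ranges of [n] *)

Theorem theorem3p3 (R : realType) :
  exists C C' : R, 0 < C /\ 0 < C' /\
  forall f : R -> R,
    (forall x y : R, 0 < x -> x <= y -> f x <= f y) ->
    (forall x : R, 0 < x -> 2 <= f x) ->
    (forall x : R, expR 2 <= x -> f x <= ln x) ->
  forall eps : R, 0 < eps -> eps < 1 / 100 ->
  forall k : R, k = C * (Num.ceil (1 / eps ^+ 2 * ln (1 / eps) ^+ 4))%:~R ->
  forall delta : R, 1 / delta = C' * k `^ (f k - 1) ->
  forall (h : nat) (W : finType) (T : rel W),
    #|W| = h -> tournament T -> erdos_hajnal f T ->
  forall (n : nat) (V : finType) (G : rel V),
    #|V| = n -> tournament G ->
    (num_copies T G)%:R < (delta / k) ^+ (h - 1) * n%:R ^+ h ->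
    exists S : {set V},
      delta * n%:R <= #|S|%:R /\ eps_transitive eps G S.
Proof.
have e2_ge := expR2_ge3 R.
exists (2 ^+ 40), (8 * expR 2); split; first exact: exprn_gt0.
split; first by rewrite mulr_gt0 ?expR_gt0.
move=> f f_mono f_ge2 f_le_ln eps eps0 eps1 k kE delta deltaE.
move=> h W T cW TT TEH n V G cV GT few.
have [[K kK] kA L2 kL] := k_estimates eps0 eps1 kE; clear kE.
have k1 : 1 < k.
  rewrite ltNge; apply/negP => /ln_le0; lra.
have k0 : 0 < k by lra.
have ek : expR 2 <= k by rewrite -[leRHS]lnK ?posrE // ler_expR.
have fk2 := f_ge2 k k0; have fkL := f_le_ln k ek.
set c := 8 * expR 2 in deltaE.
have c24 : 24 <= c by rewrite /c; lra.
have y0 : 0 < k `^ f k by rewrite powR_gt0.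
have yE : k * k `^ (f k - 1) = k `^ f k by rewrite mulr_powRB1 ?ltW //; lra.
have z0 : 0 < k `^ (f k - 1) by rewrite powR_gt0.
have deltaE' : delta = 1 / (c * k `^ (f k - 1)) by rewrite -deltaE !div1r invrK.
have delta0 : 0 < delta by rewrite deltaE' divr_gt0 // mulr_gt0 //; lra.
have delta_k : delta / k = 1 / (c * k `^ f k).
  by rewrite deltaE' -yE; field; rewrite !gt_eqF //; lra.
have dk4 : delta / k * (4 * k `^ f k) = 4 / c.
  by rewrite delta_k; field; rewrite !gt_eqF //; lra.
have dk0 : 0 <= delta / k by rewrite divr_ge0 // ltW.
have c4 : 4 / c <= 1 / 4 by rewrite ler_pdivrMr; lra.
have h_gt1 : (1 < h)%N.
  rewrite ltnNge; apply/negP => h1; move: few.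
  rewrite (eqP (h1 : (h - 1 == 0)%N)) mul1r -natrX ltr_nat ltnNge -cV -cW.
  by rewrite num_copies_small // cW.
have W0 : (0 < #|W|)%N by rewrite cW ltnW.
apply: contrapT => noS.
have {}noS (S : {set V}) : delta * n%:R <= #|S|%:R -> ~ eps_transitive eps G S.
  by move=> cS eS; apply: noS; exists S.
have [n_ge|n_lt] := leP (4 * k `^ f k) n%:R.
  have n0 : 0 < n%:R :> R by lra.
  set p := 4 * k `^ f k / n%:R.
  have pn : n%:R * p = 4 * k `^ f k by rewrite mulrC divfK // gt_eqF.
  have p01 : 0 <= p <= 1.
    by rewrite /p divr_ge0 ?ler_pdivrMr ?mul1r // mulr_ge0 // ltW.
  have few' : (num_copies T G)%:R * p ^+ #|W| <= 4 * k `^ f k / 4.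
    rewrite -pn cW; apply: few_copies few => //; first by case/andP: p01.
    by rewrite pn dk4.
  (* Writing [y] for k^f(k), the bounds combine to [4 * y <= y + 1 + y], impossible since [y] is at
     least [k], which exceeds 1. *)
  have := sampling_bound TEH GT W0 (ltW k1) p01.
  have : \sum_(X : {set V} | acyclic G X && (k <= #|X|%:R)) p ^+ #|X| <= 1.
    apply: (sum_transitive_le1 GT _ eps0 eps1 kK kA L2 kL fk2 fkL erefl) n_ge noS.
      by rewrite cV.
    by rewrite -/c -[LHS](divfK (x := k)) ?gt_eqF // delta_k mulrAC mul1r.
  have : k `^ 1 <= k `^ f k by rewrite ler_powR ?ltW //; lra.
  rewrite (powRr1 (ltW k0)) cV (mulrC p) pn cW; rewrite cW in few'; lra.
have beta0 : 0 <= delta * n%:R by rewrite mulr_ge0 // ltW.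
(* If [delta * n] is at most 1, a single vertex, or the empty set when there is none, already serves
   as [S]; otherwise [delta * n] is an admissible argument of the Erdős-Hajnal property. *)
have [beta1|beta1] := leP (delta * n%:R) 1.
  have [V0|/card_gt0P[x _]] := posnP #|V|.
    apply: (noS set0); first by rewrite -cV V0 mulr0.
    apply: acyclic_eps_transitive => //; first exact: ltW.
    by apply/forall_inP => x; rewrite inE.
  apply: (noS [set x]); first by rewrite cards1.
  apply: acyclic_eps_transitive => //; first exact: ltW.
  apply/(acyclicP GT) => a b d; rewrite !inE => /eqP-> /eqP-> /eqP->.
  by rewrite tournament_irr.
have n0 : 0 < n%:R :> R by rewrite -(pmulr_rgt0 _ delta0); lra.
have beta_k : delta * n%:R <= k.
  have : delta / k * n%:R <= delta / k * (4 * k `^ f k).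
    by rewrite ler_wpM2l // ltW.
  rewrite dk4 mulrAC ler_pdivrMr // => hb.
  apply: (le_trans hb); rewrite ler_piMl ?ltW //; lra.
(* A transitive set is [eps]-transitive with nothing reversed, so only copies of [T] have to be
   deleted. *)
have no_large :
    [set X | [&& acyclic G X, delta * n%:R <= #|X|%:R & X \subset [set: V]]] = set0.
  apply/setP => X; rewrite !inE; apply/negP => /and3P[acX cX _].
  by apply: (noS X) => //; apply: acyclic_eps_transitive => //; exact: ltW.
have all_copies : #|[set S | is_copy T G S && (S \subset [set: V])]| = num_copies T G.
  by apply: eq_card => S; rewrite !inE subsetT andbT.
have := deletion_bound TEH GT [set: V] W0 (ltW beta1).
rewrite no_large all_copies cards0 addr0.
have : (num_copies T G)%:R * 1 ^+ h <= n%:R * 1 / 4 :> R.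
  apply: few_copies few => //.
  have : delta / k * (n%:R * 1) <= delta / k * (4 * k `^ f k).
    by rewrite mulr1 ler_wpM2l // ltW.
  by rewrite dk4; lra.
(* Monotonicity of [f] and [delta * n <= k] bound the power by [delta * n] times k^(f(k)-1), which
   is [n / c]. Deletion then gives [n <= n / 4 + n / 24], a contradiction. *)
have : (delta * n%:R) `^ f (delta * n%:R) <= n%:R / c.
  apply: (@le_trans _ _ ((delta * n%:R) `^ f k)).
    by apply: ler_powR; [exact: ltW|apply: f_mono; lra].
  have f_gt0 : 0 < f k by lra.
  rewrite -mulr_powRB1 //.
  apply: (@le_trans _ _ (delta * n%:R * k `^ (f k - 1))).
    by rewrite ler_wpM2l // ge0_ler_powR ?nnegrE //; lra.
  rewrite deltaE' (_ : _ * _ * _ = n%:R / c) //.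
  by field; rewrite !gt_eqF //; lra.
rewrite expr1n !mulr1 cardsT cV.
have : n%:R / c <= n%:R / 24 :> R by rewrite ler_pM2l // lef_pV2 ?posrE //; lra.
lra.
Qed.
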